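(* The Lie algebra $\mathfrak g=\mathrm T^*\mathfrak h_3$, with basis $e_1,\dots,e_6$ and non-zero commutators $[e_1,e_2]=e_6$, $[e_1,e_3]=-e_5$, $[e_2,e_3]=e_4$, admits Ricci-flat pseudo-Kähler metrics that are not flat. Every pseudo-Kähler metric on $\mathfrak g$ is equivalent to a metric $(E_{10},M,E_{10})$ where $M$ has the form $$M=\begin{pmatrix}m_{11}&m_{12}&0\\-m_{12}&m_{11}&0\\0&0&0\end{pmatrix}.$$
   Context: A left invariant metric is identified with a non-degenerate symmetric bilinear form on $\mathfrak g$. The triple $(S,M,E)$ denotes the left invariant metric with Gram matrix $\begin{pmatrix}S&M\\ M^T&E\end{pmatrix}$ in the basis $e_1,\dots,e_6$ (real entries), and $E_{10}=\mathrm{diag}(0,0,1)$. A complex structure on $\mathfrak g$ is an endomorphism $J$ with $J^2=-\mathrm{id}$ and $[x,y]-[Jx,Jy]+J[Jx,y]+J[x,Jy]=0$ for all $x,y\in\mathfrak g$. A symplectic structure is a closed 2-form $\Omega\in\bigwedge^2\mathfrak g^*$ of maximal rank. A pseudo-Kähler structure is a pair $(J,\Omega)$, with $J$ complex and $\Omega$ symplectic, such that $\Omega(Jx,Jy)=\Omega(x,y)$ for all $x,y$; the associated pseudo-Kähler metric is $\langle x,y\rangle=\Omega(Jx,y)$. Flat means that the curvature tensor vanishes, Ricci-flat that the Ricci tensor vanishes. Two left invariant metrics with Gram matrices $S_1,S_2$ in the basis $e_1,\dots,e_6$ are equivalent if $S_2=F^TS_1F$ for some Lie algebra automorphism $F\in\mathrm{Aut}(\mathfrak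 g)$.
   Formalization: The normal form is proved up to an overall sign: G or −G is equivalent to (E10, M, E10), since −G is pseudo-Kähler whenever G is, and automorphisms preserve the sign of the metric on the derived algebra, so the claim for G itself fails. *)

(* Defs.v *)
From mathcomp Require Import all_boot all_order all_algebra.
From mathcomp Require Import reals.

Set Implicit Arguments.
Unset Strict Implicit.
Unset Printing Implicit Defensive.

Import GRing.Theory.
Local Open Scope ring_scope.

Section TstarH3.
Variable R : realType.

(* Elements of the Lie algebra are column vectors of coordinates in the basis
   e_1, ..., e_6; the index n of [e n] and of [co n] is 1-based. *)
Definition e (n : nat) : 'cV[R]_6 := delta_mx (inord n.-1) 0.
Definition co (n : nat) (x : 'cV[R]_6) : R := x (inord n.-1) 0.

Definition bracket (x y : 'cV[R]_6) : 'cV[R]_6 :=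
    (co 1 x * co 2 y - co 2 x * co 1 y) *: e 6
  - (co 1 x * co 3 y - co 3 x * co 1 y) *: e 5
  + (co 2 x * co 3 y - co 3 x * co 2 y) *: e 4.

Definition is_automorphism (F : 'M[R]_6) : Prop :=
  F \in unitmx /\
  forall x y, F *m bracket x y = bracket (F *m x) (F *m y).

Definition bform (B : 'M[R]_6) (x y : 'cV[R]_6) : R := (x^T *m B *m y) 0 0.

Definition is_metric (G : 'M[R]_6) : Prop := G^T = G /\ G \in unitmx.

(* [equivalent] preserves the signature of the metric, and also that of its
   restriction to the derived algebra <e_4, e_5, e_6>. Since - G is a
   pseudo-Kaehler metric whenever G is one (replace Omega by - Omega), a normal
   form whose restriction to <e_4, e_5, e_6> is diag(0, 0, 1) can be reached
   only up to an overall sign of the metric. *)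
Definition equivalent (G1 G2 : 'M[R]_6) : Prop :=
  exists2 F, is_automorphism F & G2 = F^T *m G1 *m F.

(* Koszul formula, in which the derivatives of inner products of left
   invariant fields vanish:
     2 <nabla_x y, z> = <[x,y], z> - <[y,z], x> + <[z,x], y>. *)
Definition koszul (G : 'M[R]_6) (x y z : 'cV[R]_6) : R :=
  bform G (bracket x y) z - bform G (bracket y z) x + bform G (bracket z x) y.

Definition levi_civita (G : 'M[R]_6) (x y : 'cV[R]_6) : 'cV[R]_6 :=
  invmx G *m \col_(k < 6) (koszul G x y (e k.+1) / 2).

Definition curvature (G : 'M[R]_6) (x y z : 'cV[R]_6) : 'cV[R]_6 :=
    levi_civita G x (levi_civita G y z)
  - levi_civita G y (levi_civita G x z)
  - levi_civita G (bracket x y) z.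

(* The trace of the endomorphism z |-> R(z, x) y. *)
Definition ricci (G : 'M[R]_6) (x y : 'cV[R]_6) : R :=
  \sum_(k < 6) co k.+1 (curvature G (e k.+1) x y).

Definition flat (G : 'M[R]_6) : Prop := forall x y z, curvature G x y z = 0.

Definition ricci_flat (G : 'M[R]_6) : Prop := forall x y, ricci G x y = 0.

Definition is_complex_structure (J : 'M[R]_6) : Prop :=
  J *m J = - 1%:M /\
  forall x y, bracket x y - bracket (J *m x) (J *m y)
    + J *m bracket (J *m x) y + J *m bracket x (J *m y) = 0.

(* A 2-form is given by its skew-symmetric matrix; closedness is the vanishing
   of the Chevalley-Eilenberg differential. *)
Definition is_symplectic (W : 'M[R]_6) : Prop :=
  [/\ W^T = - W,
      forall x y z, bform W (bracket x y) z + bform W (bracket y z) x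
        + bform W (bracket z x) y = 0
    & \rank W = 6%N].

Definition is_pseudo_kahler (J W : 'M[R]_6) : Prop :=
  [/\ is_complex_structure J, is_symplectic W
    & forall x y, bform W (J *m x) (J *m y) = bform W x y].

Definition is_pseudo_kahler_metric (G : 'M[R]_6) : Prop :=
  exists J W, is_pseudo_kahler J W /\
    forall x y, bform G x y = bform W (J *m x) y.

Definition gram (S M E : 'M[R]_3) : 'M[R]_6 := block_mx S M M^T E.

Definition mx3 (s : seq (seq R)) : 'M[R]_3 :=
  \matrix_(i < 3, j < 3) (nth [::] s i)`_j.

Definition E10 : 'M[R]_3 := mx3 [:: [:: 0; 0; 0];
                                    [:: 0; 0; 0];
                                    [:: 0; 0; 1]].

Definition normal_M (m11 m12 : R) : 'M[R]_3 := mx3 [:: [::   m11; m12; 0];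
                                                       [:: - m12; m11; 0];
                                                       [::     0;   0; 0]].

End TstarH3.

(* Main.v *)
Require Import Defs.
From mathcomp Require Import all_boot all_order all_algebra.
From mathcomp Require Import boolp reals ring lra.
Import Order.TTheory GRing.Theory Num.Theory.
Set Implicit Arguments.
Unset Strict Implicit.
Unset Printing Implicit Defensive.
Local Open Scope ring_scope.

(** A vector [x] and a complex structure [J] generate the frame
      f1 = x,  f2 = J x,  f6 = [f1, f2],  f3 = - J f6,
      f4 = [f2, f3],  f5 = [f3, f1].
    Integrability applied to the central vector [f6] shows that [ad f3] commutes
    with [J], so [J f3 = f6] and [J f4 = f5]. The centre Z is Lagrangian for the
    symplectic form, and closedness on [f1, f2, f3] gives
    <f6, f6> = 2 <f1, f5>; hence the Gram matrix of the frame only depends on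
    <f1, f1>, <f1, f3>, <f1, f4>, <f1, f5> and <f1, f6>.
    Since [dim Z] is odd, [J] does not preserve Z, hence [f3] is not central for
    some [x], and then <f6, f6> is nonzero because Z is Lagrangian. Replacing
    [x] by [x + a f3 + b f6] kills <f1, f3> and <f1, f6> (a linear system of
    determinant - (<f1, f4>^2 + 9 <f1, f5>^2)), then [x + d f5] kills <f1, f1>,
    and rescaling [x] makes <f6, f6> equal to 1 up to sign. *)

(** * Coordinate calculus in the basis [e 1], ..., [e 6] *)

Section Coordinates.
Variable R : realType.
Implicit Types (x y z : 'cV[R]_6) (a : R) (A G : 'M[R]_6).

Lemma eq_co x y :
  co 1 x = co 1 y -> co 2 x = co 2 y -> co 3 x = co 3 y ->
  co 4 x = co 4 y -> co 5 x = co 5 y -> co 6 x = co 6 y -> x = y.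
Proof.
move=> h1 h2 h3 h4 h5 h6; apply/matrixP=> i j; rewrite ord1 -[i]inord_val.
by case: i => [[|[|[|[|[|[|?]]]]]] ?].
Qed.

Lemma co0 n : co n (0 : 'cV[R]_6) = 0. Proof. by rewrite /co mxE. Qed.
Lemma coD n x y : co n (x + y) = co n x + co n y. Proof. by rewrite /co mxE. Qed.
Lemma coN n x : co n (- x) = - co n x. Proof. by rewrite /co mxE. Qed.
Lemma coZ n a x : co n (a *: x) = a * co n x. Proof. by rewrite /co mxE. Qed.

Lemma co_e (k l : nat) : (k < 6)%N -> (l < 6)%N ->
  co k.+1 (e R l.+1) = (k == l)%:R.
Proof.
by move=> hk hl; rewrite /co /e mxE eqxx andbT -val_eqE /= !inordK.
Qed.

Lemma co_col (f : nat -> R) (k : nat) : (k < 6)%N ->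
  co k.+1 (\col_(i < 6) f i) = f k.
Proof. by move=> hk; rewrite /co mxE inordK. Qed.

Lemma co_bracket x y :
  (co 1 (bracket x y) = 0) * (co 2 (bracket x y) = 0) * (co 3 (bracket x y) = 0)
  * (co 4 (bracket x y) = co 2 x * co 3 y - co 3 x * co 2 y)
  * (co 5 (bracket x y) = co 3 x * co 1 y - co 1 x * co 3 y)
  * (co 6 (bracket x y) = co 1 x * co 2 y - co 2 x * co 1 y).
Proof. by rewrite /bracket !(coD, coN, coZ) !co_e //=; do !split; ring. Qed.

Definition coE := (co0, coD, coN, coZ, co_bracket).

(** Entries are indexed by natural numbers, so that for a literal matrix the right-hand side reduces
    by computation to a polynomial expression. *)
Lemma co_mulmx (f : nat -> nat -> R) (k : nat) x : (k < 6)%N ->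
  co k.+1 ((\matrix_(i < 6, j < 6) f i j) *m x) =
  f k 0%N * co 1 x + f k 1%N * co 2 x + f k 2%N * co 3 x
  + f k 3%N * co 4 x + f k 4%N * co 5 x + f k 5%N * co 6 x.
Proof.
move=> hk; rewrite {1}/co mxE.
under eq_bigr => i _ do rewrite mxE inordK //.
rewrite (eq_bigr (fun i : 'I_6 => f k i * co i.+1 x)); last first.
  by move=> i _; rewrite /co /= inord_val.
by rewrite !big_ord_recr big_ord0 /= add0r.
Qed.

Lemma bform_co G x y : bform G x y =
  co 1 x * co 1 (G *m y) + co 2 x * co 2 (G *m y) + co 3 x * co 3 (G *m y)
  + co 4 x * co 4 (G *m y) + co 5 x * co 5 (G *m y) + co 6 x * co 6 (G *m y).
Proof.
rewrite /bform -mulmxA mxE.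
rewrite (eq_bigr (fun i : 'I_6 => co i.+1 x * co i.+1 (G *m y))); last first.
  by move=> i _; rewrite mxE /co /= inord_val.
by rewrite !big_ord_recr big_ord0 /= add0r.
Qed.

Definition mx6 (s : seq (seq R)) : 'M[R]_6 :=
  \matrix_(i < 6, j < 6) (nth [::] s i)`_j.

Lemma co_mx6 (s : seq (seq R)) (k : nat) x : (k < 6)%N ->
  co k.+1 (mx6 s *m x) =
  (nth [::] s k)`_0 * co 1 x + (nth [::] s k)`_1 * co 2 x
  + (nth [::] s k)`_2 * co 3 x + (nth [::] s k)`_3 * co 4 x
  + (nth [::] s k)`_4 * co 5 x + (nth [::] s k)`_5 * co 6 x.
Proof. exact: (co_mulmx (fun i j => (nth [::] s i)`_j)). Qed.

Lemma eq_mulcV (A B : 'M[R]_6) : (forall x, A *m x = B *m x) -> A = B.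
Proof.
move=> h; apply/matrixP=> i j; have /colP/(_ i) := h (delta_mx j 0).
by rewrite -!colE !mxE.
Qed.

End Coordinates.

(** * A Ricci-flat pseudo-Kähler metric that is not flat *)

Section Example.
Variable R : realType.
Implicit Types (x y z : 'cV[R]_6).

(* The frame of [e 1] is [e 1, ..., e 6], with <f1, f4> = 0 and <f1, f5> = 1. *)
Definition ex_J : 'M[R]_6 := mx6
  [:: [:: 0; -1; 0; 0; 0; 0];
      [:: 1;  0; 0; 0; 0; 0];
      [:: 0;  0; 0; 0; 0; -1];
      [:: 0;  0; 0; 0; -1; 0];
      [:: 0;  0; 0; 1; 0; 0];
      [:: 0;  0; 1; 0; 0; 0]].

Definition ex_W : 'M[R]_6 := mx6
  [:: [:: 0; 0; 0; 1; 0; 0];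
      [:: 0; 0; 0; 0; 1; 0];
      [:: 0; 0; 0; 0; 0; -2];
      [:: -1; 0; 0; 0; 0; 0];
      [:: 0; -1; 0; 0; 0; 0];
      [:: 0; 0; 2; 0; 0; 0]].

Definition ex_G : 'M[R]_6 := mx6
  [:: [:: 0; 0; 0; 0; 1; 0];
      [:: 0; 0; 0; -1; 0; 0];
      [:: 0; 0; 2; 0; 0; 0];
      [:: 0; -1; 0; 0; 0; 0];
      [:: 1; 0; 0; 0; 0; 0];
      [:: 0; 0; 0; 0; 0; 2]].

(** Closed form of the Levi-Civita connection of [ex_G], as [ex_levi_civita] confirms. *)
Definition ex_nabla x y : 'cV[R]_6 := \col_(i < 6) [::
    0; 0; (co 1 x * co 1 y + co 2 x * co 2 y) / 2;
    co 2 x * co 3 y + co 1 x * co 6 y + co 6 x * co 1 y;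
    co 2 x * co 6 y + co 6 x * co 2 y - co 1 x * co 3 y;
    (co 1 x * co 2 y - co 2 x * co 1 y) / 2]`_i.

Lemma ex_J_sq : ex_J *m ex_J = - 1%:M.
Proof.
apply: eq_mulcV => x; rewrite mulNmx mul1mx -mulmxA.
apply: eq_co; rewrite coN !co_mx6 //=; ring.
Qed.

Lemma ex_J_complex : is_complex_structure ex_J.
Proof.
split=> [|x y]; first exact: ex_J_sq.
apply: eq_co; rewrite !(coE, co_mx6) //=; ring.
Qed.

Lemma ex_G_sym : ex_G^T = ex_G.
Proof.
apply/matrixP=> i j; rewrite !mxE.
by case: i j => [[|[|[|[|[|[|?]]]]]] ?] [[|[|[|[|[|[|?]]]]]] ?].
Qed.

Lemma ex_G_unit : ex_G \in unitmx.
Proof.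
have: ex_G *m mx6
  [:: [:: 0; 0; 0; 0; 1; 0];
      [:: 0; 0; 0; -1; 0; 0];
      [:: 0; 0; 2^-1; 0; 0; 0];
      [:: 0; -1; 0; 0; 0; 0];
      [:: 1; 0; 0; 0; 0; 0];
      [:: 0; 0; 0; 0; 0; 2^-1]] = 1%:M.
  apply: eq_mulcV => x; rewrite mul1mx -mulmxA.
  by apply: eq_co; rewrite !co_mx6 //=; field.
by case/mulmx1_unit.
Qed.

Lemma ex_W_unit : ex_W \in unitmx.
Proof.
have: ex_W *m mx6
  [:: [:: 0; 0; 0; -1; 0; 0];
      [:: 0; 0; 0; 0; -1; 0];
      [:: 0; 0; 0; 0; 0; 2^-1];
      [:: 1; 0; 0; 0; 0; 0];
      [:: 0; 1; 0; 0; 0; 0];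
      [:: 0; 0; - 2^-1; 0; 0; 0]] = 1%:M.
  apply: eq_mulcV => x; rewrite mul1mx -mulmxA.
  by apply: eq_co; rewrite !co_mx6 //=; field.
by case/mulmx1_unit.
Qed.

(* Unqualified, [is_symplectic] is the one of MathComp's sesquilinear forms. *)
Lemma ex_W_symplectic : Defs.is_symplectic ex_W.
Proof.
split; last exact: mxrank_unit ex_W_unit.
  apply: eq_mulcV => x.
  have -> : ex_W^T = mx6
    [:: [:: 0; 0; 0; -1; 0; 0];
        [:: 0; 0; 0; 0; -1; 0];
        [:: 0; 0; 0; 0; 0; 2];
        [:: 1; 0; 0; 0; 0; 0];
        [:: 0; 1; 0; 0; 0; 0];
        [:: 0; 0; -2; 0; 0; 0]].
    apply/matrixP=> i j; rewrite !mxE.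
    by case: i j => [[|[|[|[|[|[|?]]]]]] ?] [[|[|[|[|[|[|?]]]]]] ?].
  by apply: eq_co; rewrite mulNmx coN !co_mx6 //=; ring.
by move=> x y z; rewrite !bform_co !(coE, co_mx6) //=; ring.
Qed.

Lemma ex_pseudo_kahler : is_pseudo_kahler ex_J ex_W.
Proof.
split; [exact: ex_J_complex | exact: ex_W_symplectic |].
by move=> x y; rewrite !bform_co !co_mx6 //=; ring.
Qed.

Lemma ex_G_pseudo_kahler : is_pseudo_kahler_metric ex_G.
Proof.
exists ex_J, ex_W; split; first exact: ex_pseudo_kahler.
by move=> x y; rewrite !bform_co !co_mx6 //=; ring.
Qed.

Lemma co_ex_nabla x y :
  (co 1 (ex_nabla x y) = 0) * (co 2 (ex_nabla x y) = 0)
  * (co 3 (ex_nabla x y) = (co 1 x * co 1 y + co 2 x * co 2 y) / 2)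
  * (co 4 (ex_nabla x y) =
       co 2 x * co 3 y + co 1 x * co 6 y + co 6 x * co 1 y)
  * (co 5 (ex_nabla x y) =
       co 2 x * co 6 y + co 6 x * co 2 y - co 1 x * co 3 y)
  * (co 6 (ex_nabla x y) = (co 1 x * co 2 y - co 2 x * co 1 y) / 2).
Proof.
rewrite /ex_nabla.
by do !split; apply: etrans (co_col (fun i => [:: _; _; _; _; _; _]`_i) _) _.
Qed.

Lemma ex_levi_civita x y : levi_civita ex_G x y = ex_nabla x y.
Proof.
(* Writing the right-hand side as [invmx ex_G *m (ex_G *m _)] cancels the inverse, so only the
   Koszul identity for [ex_nabla] has to be checked. *)
rewrite /levi_civita -[RHS](mulKmx ex_G_unit); congr (_ *m _).
apply: eq_co;
  rewrite (co_col (fun k => koszul ex_G x y (e R k.+1) / 2)) //;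
  by rewrite /koszul !bform_co !(coE, co_mx6, co_ex_nabla) // !co_e //=; field.
Qed.

Lemma ex_curvature x y z :
  let d := co 1 x * co 2 y - co 2 x * co 1 y in
  curvature ex_G x y z = - (2 * d * co 1 z) *: e R 4 - (2 * d * co 2 z) *: e R 5.
Proof.
rewrite /curvature !ex_levi_civita /=.
by apply: eq_co; rewrite !(coE, co_ex_nabla) !co_e //=; field.
Qed.

(** The curvature takes values in the span of [e 4] and [e 5], and it vanishes when its first
    argument is one of these two; so every diagonal entry of the trace is zero. *)
Lemma ex_ricci_flat : ricci_flat ex_G.
Proof.
move=> x y; rewrite /ricci !big_ord_recr big_ord0 /=.
by rewrite !ex_curvature !coE !co_e //=; ring.
Qed.

Lemma ex_not_flat : ~ flat ex_G.
Proof.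
move=> /(_ (e R 1) (e R 2) (e R 1)) /(congr1 (co 4)).
by rewrite ex_curvature !coE !co_e //=; lra.
Qed.

End Example.

(** * Bilinearity, the centre, and the bracket as a cross product *)

Section Bilinear.
Variable R : realType.
Implicit Types (p q u v w x y z : 'cV[R]_6) (a : R) (B : 'M[R]_6).

Lemma bformDl B x y z : bform B (x + y) z = bform B x z + bform B y z.
Proof. by rewrite /bform linearD !mulmxDl mxE. Qed.
Lemma bformDr B x y z : bform B x (y + z) = bform B x y + bform B x z.
Proof. by rewrite /bform mulmxDr mxE. Qed.
Lemma bformZl B a x y : bform B (a *: x) y = a * bform B x y.
Proof. by rewrite /bform linearZ -!scalemxAl mxE. Qed.
Lemma bformZr B a x y : bform B x (a *: y) = a * bform B x y.
Proof. by rewrite /bform -scalemxAr mxE. Qed.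
Lemma bformNl B x y : bform B (- x) y = - bform B x y.
Proof. by rewrite -scaleN1r bformZl mulN1r. Qed.
Lemma bformNr B x y : bform B x (- y) = - bform B x y.
Proof. by rewrite -scaleN1r bformZr mulN1r. Qed.
Lemma bform0r B x : bform B x 0 = 0.
Proof. by rewrite -(scale0r 0) bformZr mul0r. Qed.
Lemma bform_tr B x y : bform B^T x y = bform B y x.
Proof. by rewrite /bform -{1}[y]trmxK -!trmx_mul mulmxA mxE. Qed.
Lemma bform_opp B x y : bform (- B) x y = - bform B x y.
Proof. by rewrite /bform mulmxN mulNmx mxE. Qed.

Definition bformE := (bformDl, bformDr, bformZl, bformZr, bformNl, bformNr).

Lemma bracketC x y : bracket x y = - bracket y x.
Proof. by apply: eq_co; rewrite !coE; ring. Qed.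
Lemma bracketDl x y z : bracket (x + y) z = bracket x z + bracket y z.
Proof. by apply: eq_co; rewrite !coE; ring. Qed.
Lemma bracketDr x y z : bracket x (y + z) = bracket x y + bracket x z.
Proof. by apply: eq_co; rewrite !coE; ring. Qed.
Lemma bracketZl a x y : bracket (a *: x) y = a *: bracket x y.
Proof. by apply: eq_co; rewrite !coE; ring. Qed.
Lemma bracketZr a x y : bracket x (a *: y) = a *: bracket x y.
Proof. by apply: eq_co; rewrite !coE; ring. Qed.
Lemma bracketNl x y : bracket (- x) y = - bracket x y.
Proof. by apply: eq_co; rewrite !coE; ring. Qed.
Lemma bracketNr x y : bracket x (- y) = - bracket x y.
Proof. by apply: eq_co; rewrite !coE; ring. Qed.

(** The centre in coordinates; it coincides with the derived algebra. *)
Definition central x := [/\ co 1 x = 0, co 2 x = 0 & co 3 x = 0].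

Lemma central_bracket x y : central (bracket x y).
Proof. by split; rewrite coE. Qed.
Lemma bracket_centrall z y : central z -> bracket z y = 0.
Proof. by case=> h1 h2 h3; apply: eq_co; rewrite !coE ?h1 ?h2 ?h3; ring. Qed.
Lemma bracket_centralr z y : central z -> bracket y z = 0.
Proof. by move=> h; rewrite bracketC bracket_centrall ?oppr0. Qed.
Lemma centralD x y : central x -> central y -> central (x + y).
Proof.
case=> h1 h2 h3 [k1 k2 k3].
by split; rewrite coD ?(h1, h2, h3) ?(k1, k2, k3) addr0.
Qed.
Lemma centralZ a x : central x -> central (a *: x).
Proof. by case=> h1 h2 h3; split; rewrite coZ ?(h1,h2,h3) mulr0. Qed.
Lemma centralN x : central x -> central (- x).
Proof. by rewrite -scaleN1r; apply: centralZ. Qed.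

Lemma bracket_e : (bracket (e R 1) (e R 2) = e R 6)
  * (bracket (e R 3) (e R 1) = e R 5) * (bracket (e R 2) (e R 3) = e R 4).
Proof. by do !split; apply: eq_co; rewrite !coE !co_e //=; ring. Qed.

Lemma central_e z : central z ->
  z = co 4 z *: bracket (e R 2) (e R 3) + co 5 z *: bracket (e R 3) (e R 1)
    + co 6 z *: bracket (e R 1) (e R 2).
Proof.
move=> [h1 h2 h3]; rewrite !bracket_e.
by apply: eq_co; rewrite !coE !co_e //= ?h1 ?h2 ?h3; ring.
Qed.

(* On the first three coordinates the bracket is the cross product of R^3. *)
Lemma bracket_surj v u : ~ central v -> central u ->
  co 1 v * co 4 u + co 2 v * co 5 u + co 3 v * co 6 u = 0 ->
  exists y, u = bracket v y.
Proof.
move=> nv [u1 u2 u3] vu.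
have n0 : co 1 v ^+ 2 + co 2 v ^+ 2 + co 3 v ^+ 2 != 0.
  apply/eqP=> h; apply: nv.
  have h1 := sqr_ge0 (co 1 v); have h2 := sqr_ge0 (co 2 v).
  have h3 := sqr_ge0 (co 3 v).
  by split; apply/eqP; rewrite -sqrf_eq0; apply/eqP; lra.
set n := _ + _ in n0.
(* With [u] read in coordinates 4, 5, 6 and [v] in coordinates 1, 2, 3, this is (u × v) / |v|^2, and
   v × (u × v) = |v|^2 u - (v·u) v. *)
set y := n^-1 *: ((co 3 v * co 5 u - co 2 v * co 6 u) *: e R 1
             + (co 1 v * co 6 u - co 3 v * co 4 u) *: e R 2
             + (co 2 v * co 4 u - co 1 v * co 5 u) *: e R 3).
exists y.
have y1 : co 1 y = n^-1 * (co 3 v * co 5 u - co 2 v * co 6 u).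
  by rewrite /y !coE !co_e //=; ring.
have y2 : co 2 y = n^-1 * (co 1 v * co 6 u - co 3 v * co 4 u).
  by rewrite /y !coE !co_e //=; ring.
have y3 : co 3 y = n^-1 * (co 2 v * co 4 u - co 1 v * co 5 u).
  by rewrite /y !coE !co_e //=; ring.
(* The summand [0] is a slot for the term (v·u) v of the double cross product, which vanishes by
   [vu]. *)
have key a b : n * a = n * b + 0 -> a = b.
  by rewrite addr0; apply: mulfI.
apply: eq_co; rewrite !co_bracket ?y1 ?y2 ?y3 //; apply: key.
- by rewrite -(mulr0 (co 1 v)) -vu /n; field.
- by rewrite -(mulr0 (co 2 v)) -vu /n; field.
- by rewrite -(mulr0 (co 3 v)) -vu /n; field.
Qed.

(** Shaped for [v = x], [u = f3], [z = f6], [y = f2], where the second argument is [J] of the first.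
    The term in [a * b] is a multiple of [u, u]. *)
Lemma bracket_shift z u v y (a b : R) : central z ->
  bracket (v + a *: u + b *: z) (y + a *: z - b *: u) =
  bracket v y - b *: bracket v u + a *: bracket u y.
Proof.
by case=> h1 h2 h3; apply: eq_co; rewrite !coE ?h1 ?h2 ?h3; ring.
Qed.

Lemma bform_shift B u v w p q z (a b c d : R) :
  bform B (u + a *: v + b *: w) (p + c *: q + d *: z) =
  bform B u p + c * bform B u q + d * bform B u z
  + a * (bform B v p + c * bform B v q + d * bform B v z)
  + b * (bform B w p + c * bform B w q + d * bform B w z).
Proof. by rewrite !bformE; ring. Qed.

End Bilinear.

(** * The frame generated by a vector and a complex structure *)

Section Frame.
Variables (R : realType) (J : 'M[R]_6).
Implicit Types (x y z : 'cV[R]_6).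
Hypothesis J_complex : is_complex_structure J.

Lemma JJ x : J *m (J *m x) = - x.
Proof. by case: J_complex => h _; rewrite mulmxA h mulNmx mul1mx. Qed.

(** In the integrability condition at [z], [y], the two brackets that contain [z] itself vanish. *)
Lemma ad_J_comm z y : central z ->
  J *m bracket (J *m z) y = bracket (J *m z) (J *m y).
Proof.
move=> cz; case: J_complex => _ /(_ z y).
rewrite (bracket_centrall _ cz) (bracket_centrall (J *m y) cz).
by rewrite mulmx0 addr0 sub0r addrC => /subr0_eq.
Qed.

(* [frk] is the vector [fk] of the header; [f1] is [x] itself. *)
Definition fr2 x := J *m x.
Definition fr6 x := bracket x (J *m x).
Definition fr3 x := - (J *m fr6 x).
Definition fr4 x := bracket (fr2 x) (fr3 x).
Definition fr5 x := bracket (fr3 x) x.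

Lemma J_f2 x : J *m fr2 x = - x. Proof. exact: JJ. Qed.
Lemma J_f6 x : J *m fr6 x = - fr3 x. Proof. by rewrite /fr3 opprK. Qed.
Lemma J_f3 x : J *m fr3 x = fr6 x. Proof. by rewrite /fr3 mulmxN JJ opprK. Qed.

Lemma J_ad_f3 x y : J *m bracket (fr3 x) y = bracket (fr3 x) (J *m y).
Proof.
rewrite /fr3 !bracketNl mulmxN ad_J_comm //; exact: central_bracket.
Qed.

Lemma J_f5 x : J *m fr5 x = - fr4 x.
Proof. by rewrite /fr5 /fr4 J_ad_f3 bracketC. Qed.
Lemma J_f4 x : J *m fr4 x = fr5 x.
Proof. by rewrite -[fr4 x]opprK -J_f5 mulmxN JJ opprK. Qed.

Definition JE := (J_f2, J_f3, J_f4, J_f5, J_f6).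

Lemma central_f4 x : central (fr4 x). Proof. exact: central_bracket. Qed.
Lemma central_f5 x : central (fr5 x). Proof. exact: central_bracket. Qed.
Lemma central_f6 x : central (fr6 x). Proof. exact: central_bracket. Qed.

(** If the centre were stable, the upper right 3 by 3 block of [J] would be zero, so the lower right
    block would have square -1. The square of its determinant would then be (-1)^3. *)
Lemma J_not_center_stable : ~ (forall z, central z -> central (J *m z)).
Proof.
move=> h.
pose K : 'M_(3 + 3) := J.
have K0 : ursubmx K = 0.
  apply/matrixP=> i j; rewrite !mxE.
  have cz : central (delta_mx (rshift 3 j : 'I_6) 0 : 'cV[R]_6).
    by split; rewrite /co mxE -val_eqE /= inordK.
  have [] := h _ cz; rewrite /co -colE !mxE.
  by case: i => [[|[|[|?]]] ?] // h1 h2 h3;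
    [move: h1|move: h2|move: h3] => <-; congr (K _ _);
    apply: val_inj; rewrite /= inordK.
have /(congr1 (@drsubmx _ 3 3 3 3)) : K *m K = - 1%:M.
  by case: J_complex.
rewrite -[K]submxK K0 mulmx_block block_mxKdr mulmx0 add0r.
rewrite scalar_mx_block opp_block_mx block_mxKdr => /(congr1 (@determinant _ _)).
rewrite det_mulmx -scaleN1r detZ det1 mulr1 => h2.
have := sqr_ge0 (\det (drsubmx K)); rewrite expr2 h2.
by rewrite -signr_odd /= expr1; lra.
Qed.

(* Polarizing [J [x, J x]] and adding the integrability condition isolates
   [2 J [x, J y]]. *)
Lemma exists_noncentral_f3 : exists x, ~ central (fr3 x).
Proof.
apply: contrapT => /forallNP h.
have c6 x : central (J *m bracket x (J *m x)).
  by rewrite -[X in central X]opprK; apply: centralN; apply: contrapT; apply: h.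
have cJ x y : central (J *m bracket x (J *m y)).
  have cxy : central (J *m bracket x (J *m x) + J *m bracket y (J *m x)
         + (J *m bracket x (J *m y) + J *m bracket y (J *m y))).
    have := c6 (x + y); rewrite [J *m (x + y)]mulmxDr bracketDr !bracketDl.
    move: (bracket _ _) (bracket _ _) (bracket _ _) (bracket _ _) => b1 b2 b3 b4.
    by rewrite !mulmxDr.
  case: J_complex => _ /(_ x y) N.
  have -> : J *m bracket x (J *m y) =
      2^-1 *: ((J *m bracket x (J *m x) + J *m bracket y (J *m x)
         + (J *m bracket x (J *m y) + J *m bracket y (J *m y)))
         - J *m bracket x (J *m x) - J *m bracket y (J *m y)
         + (- bracket x y + bracket (J *m x) (J *m y))
         + (bracket x y - bracket (J *m x) (J *m y)
             + J *m bracket (J *m x) y + J *m bracket x (J *m y))).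
    rewrite [bracket y _]bracketC mulmxN.
    by apply: eq_co; rewrite !(coD, coN, coZ); field.
  rewrite N addr0; apply: centralZ.
  apply: centralD; last first.
    by apply: centralD; [apply: centralN|]; exact: central_bracket.
  apply: centralD; last exact/centralN/c6.
  by apply: centralD; [exact: cxy|exact/centralN/c6].
(* Since [y] is [J] applied to [J *m (- y)], [J] sends all brackets into the centre. Brackets span
   the centre, which is therefore stable under [J]. *)
have cJ' x y : central (J *m bracket x y).
  by rewrite -[y]opprK -JJ; apply: cJ.
apply: J_not_center_stable => z /central_e ->.
move: (cJ' (e R 2) (e R 3)) (cJ' (e R 3) (e R 1)) (cJ' (e R 1) (e R 2)).
move: (bracket _ _) (bracket _ _) (bracket _ _) => b1 b2 b3 h1 h2 h3.
rewrite !mulmxDr -!scalemxAr.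
by do !apply: centralD; apply: centralZ.
Qed.

End Frame.

(** * Consequences of the symplectic form and of compatibility *)

Section PseudoKahler.
Variables (R : realType) (J W G : 'M[R]_6).
Implicit Types (x y z : 'cV[R]_6).
Hypothesis J_complex : is_complex_structure J.
Hypothesis W_symplectic : Defs.is_symplectic W.
Hypothesis W_J : forall x y, bform W (J *m x) (J *m y) = bform W x y.
Hypothesis G_W : forall x y, bform G x y = bform W (J *m x) y.

Local Notation f2 := (fr2 J).
Local Notation f3 := (fr3 J).
Local Notation f4 := (fr4 J).
Local Notation f5 := (fr5 J).
Local Notation f6 := (fr6 J).
Local Notation JE := (JE J_complex).

Lemma W_skew x y : bform W x y = - bform W y x.
Proof. by case: W_symplectic => h _ _; rewrite -bform_opp -h bform_tr. Qed.

Lemma W_alt x : bform W x x = 0.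
Proof. by have := W_skew x x; lra. Qed.

(** Closedness on [x], [y], [z'] reduces to W([x, y], z') = 0, and brackets span the centre. *)
Lemma W_center_isotropic z z' : central z -> central z' -> bform W z z' = 0.
Proof.
move=> cz cz'; rewrite (central_e cz) !bformDl !bformZl.
have h x y : bform W (bracket x y) z' = 0.
  case: W_symplectic => _ /(_ x y z') + _.
  rewrite (bracket_centralr _ cz') (bracket_centrall _ cz').
  by rewrite !(W_skew 0) !bform0r oppr0 !addr0.
by rewrite !h !mulr0 !addr0.
Qed.

(** Invariance of [W] and J^2 = -1 give W(Jx, y) = - W(x, Jy). *)
Lemma G_sym x y : bform G x y = bform G y x.
Proof. by rewrite !G_W -W_J (JJ J_complex) bformNl W_skew opprK. Qed.

Lemma G_J x y : bform G (J *m x) (J *m y) = bform G x y.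
Proof. by rewrite !G_W W_J. Qed.

(** Isotropy of the centre makes the lower right 3 by 3 block of [W] zero, and the hypothesis puts
    the first three coordinates of [v] in the left kernel of the upper right block. That block is
    invertible: a vector killed by it would give a central vector in the kernel of [W]. *)
Lemma center_lagrangian v :
  (forall z, central z -> bform W v z = 0) -> central v.
Proof.
move=> vZ.
pose K : 'M_(3 + 3) := W; pose u : 'cV_(3 + 3) := v.
have cdelta (j : 'I_3) : central (delta_mx (rshift 3 j : 'I_6) 0 : 'cV[R]_6).
  by split; rewrite /co mxE -val_eqE /= inordK.
have Kdr : drsubmx K = 0.
  apply/matrixP=> i j; have := W_center_isotropic (cdelta i) (cdelta j).
  by rewrite /bform trmx_delta -rowE -colE !mxE.
have uK : (usubmx u)^T *m ursubmx K = 0.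
  have E : u^T *m K = row_mx ((usubmx u)^T *m ulsubmx K
      + (dsubmx u)^T *m dlsubmx K) ((usubmx u)^T *m ursubmx K).
    rewrite -{1}(vsubmxK u) -{1}(submxK K) Kdr tr_col_mx mul_row_block.
    by rewrite mulmx0 addr0.
  apply/rowP=> j; have := vZ _ (cdelta j); rewrite /bform -colE mxE.
  move/matrixP: E => /(_ 0 (rshift 3 j)); rewrite row_mxEr => <-.
  by move=> vZj; rewrite [RHS]mxE; exact: vZj.
have [Ku|nKu] := boolP (ursubmx K \in unitmx).
  have /matrixP u0 : usubmx u = 0.
    by apply: trmx_inj; rewrite -[LHS](mulmxK Ku) uK mul0mx trmx0.
  by split; [move: (u0 ord0 0)|move: (u0 (inord 1) 0)|move: (u0 (inord 2) 0)];
    rewrite !mxE => <-; congr (u _ _); apply: val_inj; rewrite /= !inordK.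
have : \det (ursubmx K)^T == 0 by rewrite det_tr -[_ == 0]negbK -unitfE.
case/det0P => w w0 wK; case/negP: w0; apply/eqP.
have Wu : W \in unitmx.
  by case: W_symplectic => _ _ h; rewrite -row_full_unit /row_full h.
have : K *m col_mx 0 w^T = 0.
  rewrite -[K]submxK mul_block_col !mulmx0 Kdr mul0mx add0r addr0.
  by rewrite -[ursubmx K]trmxK -trmx_mul wK trmx0 col_mx0.
move/(congr1 (mulmx (invmx W))); rewrite mulKmx // mulmx0.
move/(congr1 (@dsubmx R 3 3 1)); rewrite col_mxKd linear0.
by move/(congr1 trmx); rewrite trmxK trmx0.
Qed.

(** The centre is the image of ad f3 plus the line of f6. The form W(f3, .) vanishes on that image;
    if <f6, f6> = 0 it also vanishes on f6, hence on the whole centre, and then f3 is central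
    because the centre is Lagrangian. *)
Lemma G_f6_neq0 x : ~ central (f3 x) -> bform G (f6 x) (f6 x) != 0.
Proof.
move=> nc; apply/eqP=> a0; apply: (nc).
(* By [bracket_surj], central vectors in the kernel of [dot] lie in the image of ad f3. *)
pose dot (z : 'cV[R]_6) :=
  co 1 (f3 x) * co 4 z + co 2 (f3 x) * co 5 z + co 3 (f3 x) * co 6 z.
(* If f6 = [f3, y], then f3 = - J f6 = - [f3, J y] is central. *)
have q0 : dot (f6 x) != 0.
  apply/eqP=> q0; case: (bracket_surj nc (central_f6 J x) q0) => y hy.
  apply: (nc); rewrite /f3 hy J_ad_f3 //; apply: centralN.
  exact: central_bracket.
have fU y : bform W (f3 x) (bracket (f3 x) y) = 0.
  rewrite -W_J JE J_ad_f3 //; apply: W_center_isotropic; first exact: central_f6.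
  exact: central_bracket.
have f66 : bform W (f3 x) (f6 x) = 0.
  by move: a0; rewrite G_W JE bformNl => /eqP; rewrite oppr_eq0 => /eqP.
apply: center_lagrangian => z cz.
have cz' : central (z - (dot z / dot (f6 x)) *: f6 x).
  by apply: centralD => //; apply: centralN; apply: centralZ; apply: central_f6.
have dotB c : dot (z - c *: f6 x) = dot z - c * dot (f6 x).
  by rewrite /dot !(coD, coN, coZ); ring.
have [|y hy] := bracket_surj nc cz'.
  by rewrite [LHS]dotB divfK // subrr.
by have := fU y; rewrite -hy bformDr bformNr bformZr f66 mulr0 subr0.
Qed.

(** * Gram matrix of the frame *)

Section GramFrame.
Variable x : 'cV[R]_6.
Local Notation r := (bform G x (f6 x)).
Local Notation s := (bform G x (f3 x)).
Local Notation t := (bform G x x).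
Local Notation m11 := (bform G x (f4 x)).
Local Notation m12 := (bform G x (f5 x)).
Local Notation c4 := (central_f4 J x).
Local Notation c5 := (central_f5 J x).
Local Notation c6 := (central_f6 J x).

(** In this list [Gij] stands for <fi, fj>. Each entry follows from applying [J] to both arguments,
    from [W] being alternating, or from isotropy of the centre. *)
Lemma G12 : bform G x (f2 x) = 0. Proof. by rewrite G_W W_alt. Qed.
Lemma G22 : bform G (f2 x) (f2 x) = t. Proof. exact: G_J. Qed.
Lemma G26 : bform G (f2 x) (f6 x) = s.
Proof. by rewrite -[RHS]G_J !JE. Qed.
Lemma G23 : bform G (f2 x) (f3 x) = - r.
Proof. by rewrite -[LHS]G_J !JE bformNl. Qed.
Lemma G36 : bform G (f3 x) (f6 x) = 0.
Proof. by rewrite G_W JE W_alt. Qed.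
Lemma G33 : bform G (f3 x) (f3 x) = bform G (f6 x) (f6 x).
Proof. by rewrite -[LHS]G_J !JE. Qed.
Lemma G44 : bform G (f4 x) (f4 x) = 0.
Proof. by rewrite G_W JE; apply: W_center_isotropic c5 c4. Qed.
Lemma G45 : bform G (f4 x) (f5 x) = 0.
Proof. by rewrite G_W JE W_alt. Qed.
Lemma G55 : bform G (f5 x) (f5 x) = 0.
Proof. by rewrite G_W JE bformNl (W_center_isotropic c4 c5) oppr0. Qed.
Lemma G46 : bform G (f4 x) (f6 x) = 0.
Proof. by rewrite G_W JE; apply: W_center_isotropic c5 c6. Qed.
Lemma G56 : bform G (f5 x) (f6 x) = 0.
Proof. by rewrite G_W JE bformNl (W_center_isotropic c4 c6) oppr0. Qed.
Lemma G34 : bform G (f3 x) (f4 x) = 0.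
Proof. by rewrite -G_J !JE G_sym G56. Qed.
Lemma G35 : bform G (f3 x) (f5 x) = 0.
Proof. by rewrite -G_J !JE bformNr G_sym G46 oppr0. Qed.
Lemma G25 : bform G (f2 x) (f5 x) = m11.
Proof. by rewrite -[RHS]G_J !JE. Qed.
Lemma G24 : bform G (f2 x) (f4 x) = - m12.
Proof. by rewrite -[LHS]G_J !JE bformNl. Qed.

(** The three terms of closedness on f1, f2, f3 are <f6, f6>, - <f1, f5> and - <f1, f5>. *)
Lemma G66 : bform G (f6 x) (f6 x) = 2 * m12.
Proof.
case: W_symplectic => _ /(_ x (f2 x) (f3 x)) + _.
rewrite -/(f6 x) -/(f4 x) -/(f5 x).
have -> : bform W (f6 x) (f3 x) = bform G (f6 x) (f6 x).
  by rewrite G_W JE bformNl -W_skew.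
have -> : bform W (f4 x) x = - m12.
  by rewrite G_sym G_W JE bformNl opprK.
have -> : bform W (f5 x) (f2 x) = - m12.
  by rewrite -G24 G_sym G_W JE.
lra.
Qed.

End GramFrame.

(** * Effect on the frame of changing its first vector *)

Section Moves.
Variable x : 'cV[R]_6.

Lemma f6_shift a b :
  f6 (x + a *: f3 x + b *: f6 x) = f6 x + b *: f5 x + (- a) *: f4 x.
Proof.
rewrite {1}/fr6.
have -> : J *m (x + a *: f3 x + b *: f6 x) = f2 x + a *: f6 x - b *: f3 x.
  by rewrite 2!mulmxDr -!scalemxAr !JE scalerN.
rewrite bracket_shift; last exact: central_f6.
by rewrite scaleNr -scalerN -scalerN -!bracketC.
Qed.

Lemma f3_shift a b :
  f3 (x + a *: f3 x + b *: f6 x) = f3 x + b *: f4 x + a *: f5 x.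
Proof.
rewrite {1}/fr3 f6_shift.
move: (J_f4 J_complex x) (J_f5 J_complex x) (J_f6 J x).
move: (f3 x) (f4 x) (f5 x) (f6 x) => u3 u4 u5 u6 j4 j5 j6.
rewrite 2!mulmxDr -2!scalemxAr j4 j5 j6.
by rewrite !opprD -scalerN -scaleNr !opprK.
Qed.

(** Both f5 and J f5 = - f4 are central, so neither correction reaches the bracket. *)
Lemma f6_shift_f5 d : f6 (x + d *: f5 x) = f6 x.
Proof.
rewrite {1}/fr6 mulmxDr -scalemxAr J_f5 // bracketDl bracketDr.
rewrite bracketZl (bracket_centrall _ (central_f5 J x)) scaler0 addr0.
rewrite bracketZr bracketNr (bracket_centralr _ (central_f4 J x)).
by rewrite oppr0 scaler0 addr0.
Qed.

Lemma f6_scale l : f6 (l *: x) = l ^+ 2 *: f6 x.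
Proof. by rewrite /fr6 -scalemxAr bracketZl bracketZr scalerA expr2. Qed.

End Moves.

Lemma f3_f6 x y c : f6 y = c *: f6 x -> f3 y = c *: f3 x.
Proof. by rewrite /fr3 => ->; rewrite -scalemxAr scalerN. Qed.

Lemma kill_mixed_terms x : bform G (f6 x) (f6 x) != 0 ->
  exists y, [/\ bform G (f6 y) (f6 y) = bform G (f6 x) (f6 x),
    bform G y (f6 y) = 0 & bform G y (f3 y) = 0].
Proof.
move=> a0; move: (a0); rewrite G66 => m0.
set m1 := bform G x (f4 x); set m2 := bform G x (f5 x) in m0.
set r := bform G x (f6 x); set s := bform G x (f3 x).
have D0 : m1 ^+ 2 + 9 * m2 ^+ 2 != 0.
  have m2_neq0 : m2 != 0 by apply: contraNneq m0 => ->; rewrite mulr0.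
  by rewrite gt_eqF // ltr_wpDl ?sqr_ge0 // mulr_gt0 // exprn_even_gt0.
set D := _ + _ in D0.
(* Cramer's rule for m1 a - 3 m2 b = r and 3 m2 a + m1 b = - s, which express <y, f6 y> = 0 and <y,
   f3 y> = 0. Quadratic terms are absent because f3 and f6 are orthogonal to f4 and f5. *)
pose a := (m1 * r - 3 * m2 * s) / D; pose b := (- 3 * m2 * r - m1 * s) / D.
have G63 : bform G (f6 x) (f3 x) = 0 by rewrite G_sym G36.
have G65 : bform G (f6 x) (f5 x) = 0 by rewrite G_sym G56.
have G64 : bform G (f6 x) (f4 x) = 0 by rewrite G_sym G46.
have G54 : bform G (f5 x) (f4 x) = 0 by rewrite G_sym G45.
exists (x + a *: f3 x + b *: f6 x); rewrite f3_shift f6_shift !bform_shift.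
rewrite G33 G34 G35 G36 G44 G45 G46 G54 G55 G56 G63 G64 G65 G66.
rewrite -/m1 -/m2 -/r -/s.
by split; [ring|rewrite /a /b /D; field|rewrite /a /b /D; field].
Qed.

Lemma kill_norm x : bform G (f6 x) (f6 x) != 0 ->
  exists y, [/\ f6 y = f6 x, bform G y (f6 y) = bform G x (f6 x),
    bform G y (f3 y) = bform G x (f3 x) & bform G y y = 0].
Proof.
rewrite G66 => a0; have m0 : bform G x (f5 x) != 0.
  by apply: contraNneq a0 => ->; rewrite mulr0.
(* As <f5, f5> = 0, the norm of x + d f5 is affine in [d], and this is its root. *)
pose d := - bform G x x / (2 * bform G x (f5 x)).
have e6 := f6_shift_f5 x d.
have e3 : f3 (x + d *: f5 x) = f3 x.
  by rewrite -[RHS]scale1r; apply: f3_f6; rewrite scale1r.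
have G53 : bform G (f5 x) (f3 x) = 0 by rewrite G_sym G35.
have expand (u v : 'cV[R]_6) c : bform G (u + c *: v) (u + c *: v) =
    bform G u u + c * (bform G u v + bform G v u) + c ^+ 2 * bform G v v.
  by rewrite !bformE; ring.
exists (x + d *: f5 x); rewrite e6 e3; split => //.
- by rewrite bformDl bformZl G56 mulr0 addr0.
- by rewrite bformDl bformZl G53 mulr0 addr0.
- by rewrite expand G55 [bform G (f5 x) x]G_sym /d; field.
Qed.

Lemma exists_adapted x : 0 < bform G (f6 x) (f6 x) ->
  exists y, [/\ bform G (f6 y) (f6 y) = 1, bform G y (f6 y) = 0,
    bform G y (f3 y) = 0 & bform G y y = 0].
Proof.
move=> a0; have [y [ay ry sy]] := kill_mixed_terms (lt0r_neq0 a0).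
have [|z [ez rz sz tz]] := @kill_norm y; first by rewrite ay lt0r_neq0.
have az : bform G (f6 z) (f6 z) = bform G (f6 x) (f6 x) by rewrite ez.
set a := bform G (f6 x) (f6 x) in a0 az.
(* Scaling the vector by [l] scales f6 by [l ^+ 2] and <f6, f6> by [l ^+ 4], hence the fourth
   root. *)
pose l := (Num.sqrt (Num.sqrt a))^-1.
have l4 : l ^+ 4 * a = 1.
  have e4 : Num.sqrt (Num.sqrt a) ^+ 4 = a.
    by rewrite (exprM _ 2 2) !sqr_sqrtr ?sqrtr_ge0 // ltW.
  by rewrite /l exprVn e4 mulVf // lt0r_neq0.
exists (l *: z); rewrite (f3_f6 (f6_scale z l)) f6_scale !bformZl !bformZr.
by rewrite az rz sz ry sy tz !mulr0; split => //; rewrite -l4; ring.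
Qed.

End PseudoKahler.

(** * Frames as automorphisms, and the normal form *)

Section NormalForm.
Variable R : realType.
Implicit Types (u v w x y : 'cV[R]_6) (a b : R) (B : 'M[R]_6).

Definition frame_mx (s : seq 'cV[R]_6) : 'M[R]_6 :=
  \matrix_(i < 6, j < 6) co i.+1 (nth 0 s j).

Definition bracket_frame u v w :=
  [:: u; v; w; bracket v w; bracket w u; bracket u v].

(** The algebra is the free 2-step nilpotent Lie algebra on [e 1], [e 2], [e 3], so any images of
    these generators extend to an endomorphism. *)
Lemma frame_mx_morph u v w x y :
  let F := frame_mx (bracket_frame u v w) in
  F *m bracket x y = bracket (F *m x) (F *m y).
Proof.
have coF := co_mulmx (fun i j => co i.+1 (nth 0 (bracket_frame u v w) j)).
move=> F.
by apply: eq_co; rewrite !(co_bracket, coF) //= ?co_bracket; ring.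
Qed.

Lemma frame_mx_gram B s i j :
  ((frame_mx s)^T *m B *m frame_mx s) i j = bform B (nth 0 s i) (nth 0 s j).
Proof.
have colF k : col k (frame_mx s) = nth 0 s k.
  by apply/colP=> l; rewrite !mxE /co /= inord_val.
rewrite /bform -!colF tr_col !mxE.
by apply: eq_bigr => k _; rewrite -row_mul !mxE.
Qed.

Definition gram_list a b : seq (seq R) :=
  [:: [:: 0; 0; 0; a; b; 0];
      [:: 0; 0; 0; - b; a; 0];
      [:: 0; 0; 1; 0; 0; 0];
      [:: a; - b; 0; 0; 0; 0];
      [:: b; a; 0; 0; 0; 0];
      [:: 0; 0; 0; 0; 0; 1]].

Lemma gram_normalE a b :
  gram (E10 R) (normal_M a b) (E10 R) = mx6 (gram_list a b).
Proof.
apply/matrixP=> i j; rewrite [RHS]mxE /gram.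
case: (split_ordP (i : 'I_(3 + 3))) => k ->;
  case: (split_ordP (j : 'I_(3 + 3))) => l ->.
- apply: etrans (block_mxEul _ _ _ _ k l) _; rewrite mxE.
  by case: k l => [[|[|[|?]]] ?] [[|[|[|?]]] ?].
- apply: etrans (block_mxEur _ _ _ _ k l) _; rewrite mxE.
  by case: k l => [[|[|[|?]]] ?] [[|[|[|?]]] ?].
- apply: etrans (block_mxEdl _ _ _ _ k l) _; rewrite !mxE.
  by case: k l => [[|[|[|?]]] ?] [[|[|[|?]]] ?].
- apply: etrans (block_mxEdr _ _ _ _ k l) _; rewrite mxE.
  by case: k l => [[|[|[|?]]] ?] [[|[|[|?]]] ?].
Qed.

Lemma gram_normal_unit a b : b != 0 -> mx6 (gram_list a b) \in unitmx.
Proof.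
move=> b0; have d0 : a ^+ 2 + b ^+ 2 != 0.
  by rewrite gt_eqF // ltr_wpDl ?sqr_ge0 // exprn_even_gt0.
set d := _ + _ in d0.
(* The inverse of the block with rows (a, b) and (- b, a) is its transpose divided by a^2 + b^2. *)
have: mx6 (gram_list a b) *m mx6
  [:: [:: 0; 0; 0; a / d; b / d; 0];
      [:: 0; 0; 0; - b / d; a / d; 0];
      [:: 0; 0; 1; 0; 0; 0];
      [:: a / d; - b / d; 0; 0; 0; 0];
      [:: b / d; a / d; 0; 0; 0; 0];
      [:: 0; 0; 0; 0; 0; 1]] = 1%:M.
  apply: eq_mulcV => x; rewrite mul1mx -mulmxA.
  by apply: eq_co; rewrite !co_mx6 //= /d; field.
by case/mulmx1_unit.
Qed.

(** The frame of an adapted vector is the image of the standard basis under an automorphism, and its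
    Gram matrix is the normal form, with [m12] equal to 1/2. *)
Lemma equivalent_normal (J W G : 'M[R]_6) x :
  is_complex_structure J -> Defs.is_symplectic W ->
  (forall x y, bform W (J *m x) (J *m y) = bform W x y) ->
  (forall x y, bform G x y = bform W (J *m x) y) ->
  0 < bform G (fr6 J x) (fr6 J x) ->
  exists m11 m12, equivalent G (gram (E10 R) (normal_M m11 m12) (E10 R)).
Proof.
move=> hJ hW WJ GW /(exists_adapted hJ hW WJ GW) [{}x [a1 r0 s0 t0]].
exists (bform G x (fr4 J x)), (bform G x (fr5 J x)).
set m11 := bform G x (fr4 J x); set m12 := bform G x (fr5 J x).
have m12E : 2 * m12 = 1 by rewrite -(G66 hJ hW WJ GW).
have m0 : m12 != 0 by apply/eqP=> m0; move: m12E; rewrite m0; lra.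
pose F := frame_mx (bracket_frame x (fr2 J x) (fr3 J x)).
have FG : F^T *m G *m F = mx6 (gram_list m11 m12).
  have E := (G12 hW GW x, G22 WJ GW x, G23 hJ WJ GW x, G24 hJ WJ GW x,
    G25 hJ WJ GW x, G26 hJ WJ GW x, G33 hJ WJ GW x).
  have E' := (G34 hJ hW WJ GW x, G35 hJ hW WJ GW x, G36 hJ hW GW x,
    G44 hJ hW GW x, G45 hJ hW GW x, G46 hJ hW GW x, G55 hJ hW GW x,
    G56 hJ hW GW x).
  have GC := G_sym hJ hW WJ GW.
  apply/matrixP=> i j; rewrite frame_mx_gram mxE.
  case: i j => [[|[|[|[|[|[|?]]]]]] ?] [[|[|[|[|[|[|?]]]]]] ?] //=;
  rewrite -?/(fr4 J x) -?/(fr5 J x) -?/(fr6 J x) //;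
  rewrite ?E ?E' ?a1 ?r0 ?s0 ?t0 ?oppr0 //;
  by rewrite GC ?E ?E' ?a1 ?r0 ?s0 ?t0 ?oppr0.
(* The frame is independent because its Gram matrix is invertible. *)
have Fu : F \in unitmx.
  have := gram_normal_unit m11 m0.
  by rewrite -FG unitmx_mul => /andP [].
by exists F; rewrite ?gram_normalE ?FG //; split => // y z; apply: frame_mx_morph.
Qed.

End NormalForm.

Theorem proposition4p7 (R : realType) :
  (exists G : 'M[R]_6,
     [/\ is_metric G, is_pseudo_kahler_metric G, ricci_flat G & ~ flat G]) /\
  (forall G : 'M[R]_6, is_metric G -> is_pseudo_kahler_metric G ->
     exists m11 m12 : R,
       equivalent G (gram (E10 R) (normal_M m11 m12) (E10 R)) \/
       equivalent (- G) (gram (E10 R) (normal_M m11 m12) (E10 R))).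
Proof.
split.
  exists (ex_G R); split; [|exact: ex_G_pseudo_kahler|exact: ex_ricci_flat|
    exact: ex_not_flat].
  by split; [exact: ex_G_sym|exact: ex_G_unit].
move=> G _ [J [W [[hJ hW WJ] GW]]].
have [x nc] := exists_noncentral_f3 hJ.
have := G_f6_neq0 hJ hW WJ GW nc.
rewrite neq_lt => /orP [a_lt0|a_gt0]; last first.
  have [m11 [m12 h]] := equivalent_normal hJ hW WJ GW a_gt0.
  by exists m11, m12; left.
(* When <f6, f6> is negative, the pair of [J] and [- W] has metric [- G], and the same [x] gives a
   positive value. *)
have hW' : Defs.is_symplectic (- W).
  case: hW => Wt Wc Wr; split; last by rewrite mxrank_opp.
    by rewrite linearN /= Wt.
  by move=> u v w; rewrite !bform_opp -!opprD Wc oppr0.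
have [|||m11 [m12 h]] := @equivalent_normal R J (- W) (- G) x hJ hW'.
- by move=> u v; rewrite !bform_opp WJ.
- by move=> u v; rewrite !bform_opp GW.
- by rewrite bform_opp oppr_gt0.
by exists m11, m12; right.
Qed.
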